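(* For every $\vec{\rho}=(p,\rho_1,\rho_2)\in[0,1]^3$, the probability that a $\vec{\rho}$-correlated pair $(A,B)$ of subsets of $I_n$ is an MSTD pair converges, as $n\to\infty$, to a limit $P(\vec{\rho})$. Moreover, $P(\vec{\rho})=0$ if $p\in\{0,1\}$ or $\rho_1+\rho_2\in\{0,2\}$, and $P(\vec{\rho})>0$ otherwise.
   Context: For an integer $n\ge 0$ let $I_n=\{0,1,\dots,n\}$. For $\vec{\rho}=(p,\rho_1,\rho_2)\in[0,1]^3$, a $\vec{\rho}$-correlated pair $(A,B)$ of subsets of $I_n$ is the random pair obtained by deciding independently for each $k\in I_n$: $k\in A$ with probability $p$; conditionally on $k\in A$, $k\in B$ with probability $\rho_1$; conditionally on $k\notin A$, $k\in B$ with probability $\rho_2$. For finite sets of integers $A,B$, $A+B=\{a+b:a\in A,b\in B\}$ and $\pm(A-B)=(A-B)\cup(B-A)=\{a-b,\,b-a:a\in A,b\in B\}$. The pair $(A,B)$ is an MSTD (sum-dominant) pair if $|A+B|>|\pm(A-B)|$. *)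

(* Defs.v *)
From HB Require Import structures.
From mathcomp Require Import all_boot all_order all_algebra.
From mathcomp Require Import finmap.
From mathcomp Require Import all_classical all_reals all_analysis.

Set Implicit Arguments.
Unset Strict Implicit.
Unset Printing Implicit Defensive.

Import Order.TTheory GRing.Theory Num.Theory.

Local Open Scope fset_scope.
Local Open Scope ring_scope.

Definition sumset (A B : {fset int}) : {fset int} :=
  [fset a + b | a in A, b in B].

Definition diffset (A B : {fset int}) : {fset int} :=
  [fset a - b | a in A, b in B].

Definition pmdiffset (A B : {fset int}) : {fset int} :=
  diffset A B `|` diffset B A.

Definition MSTD_pair (A B : {fset int}) : bool :=
  (#|` pmdiffset A B| < #|` sumset A B|)%N.

(* The index set {0, ..., n} is 'I_n.+1. *)
Definition int_set (n : nat) (A : {set 'I_n.+1}) : {fset int} :=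
  [fset (nat_of_ord k)%:Z | k in A].

(* Joint law of the indicators (k \in A, k \in B) for a single k: the chain
   rule P(k \in A) * P(k \in B | k \in A), and so on. *)
Definition elt_weight (R : realType) (p rho1 rho2 : R) (inA inB : bool) : R :=
  (if inA then p else 1 - p) *
  (let rho := if inA then rho1 else rho2 in if inB then rho else 1 - rho).

(* Probability that the correlated pair equals (A, B): the choices for distinct
   k are independent, so the weights multiply. *)
Definition pair_weight (R : realType) (p rho1 rho2 : R) (n : nat)
    (A B : {set 'I_n.+1}) : R :=
  \prod_(k < n.+1) elt_weight p rho1 rho2 (k \in A) (k \in B).

Definition correlated_prob (R : realType) (p rho1 rho2 : R) (n : nat)
    (E : {set 'I_n.+1} -> {set 'I_n.+1} -> bool) : R :=
  \sum_(AB : {set 'I_n.+1} * {set 'I_n.+1} | E AB.1 AB.2)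
    pair_weight p rho1 rho2 AB.1 AB.2.

Definition MSTD_prob (R : realType) (p rho1 rho2 : R) (n : nat) : R :=
  correlated_prob p rho1 rho2
    (fun A B : {set 'I_n.+1} => MSTD_pair (int_set A) (int_set B)).

(* Main.v *)
Require Import Defs.
From HB Require Import structures.
From mathcomp Require Import all_boot all_order all_algebra.
From mathcomp Require Import finmap.
From mathcomp Require Import all_classical all_reals all_analysis.
From mathcomp Require Import zify ring lra.

Set Implicit Arguments.
Unset Strict Implicit.
Unset Printing Implicit Defensive.

Import Order.TTheory GRing.Theory Num.Theory.
Import numFieldNormedType.Exports.

Local Open Scope classical_set_scope.
Local Open Scope ring_scope.

(* A sum k is missing only if all pairs (i, k - i) fail, and a difference d only if
   all pairs (i, i + d) fail; in both cases there are enough disjoint pairs for the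
   probability to decay exponentially in the distance of k, resp. d, to the end of
   its range. Hence, up to probability O(t^m) uniformly in n, everything is decided
   by the m first and the m last elements of the configuration, whose law does not
   depend on n: the probabilities form a Cauchy sequence. For positivity one
   prescribes a fringe that makes more differences than sums disappear, separated
   from the random middle part by long blocks which fill in all the other sums.
   In the degenerate cases one of the sets is empty or the whole interval, and then
   n - k is a difference as soon as k or 2n - k is a sum. *)

(** * Expectations over words of independent letters *)

Section Mean.
Variables (R : realDomainType) (T : finType) (w : T -> R).

(** When [w] sums to 1 this is the expectation of [F] over words of [n] independent letters of law
    [w]. The recursion makes conditioning on a block a mere unfolding, see [mean_cat]. *)
Fixpoint mean (n : nat) (F : seq T -> R) : R :=
  if n is n'.+1 then \sum_s w s * mean n' (fun l => F (s :: l)) else F [::].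

Lemma eq_mean n F G : (forall l, size l = n -> F l = G l) ->
  mean n F = mean n G.
Proof.
elim: n F G => [|n IH] F G FG /=; first exact: FG.
by apply: eq_bigr => s _; congr (_ * _); apply: IH => l sl; apply: FG => /=; rewrite sl.
Qed.

Lemma mean_sum n (I : Type) (r : seq I) (P : pred I) (F : I -> seq T -> R) :
  mean n (fun l => \sum_(i <- r | P i) F i l)
    = \sum_(i <- r | P i) mean n (F i).
Proof.
elim: n F => [|n IH] F //=.
rewrite exchange_big /=; apply: eq_bigr => s _.
by rewrite -big_distrr /= -IH.
Qed.

Lemma meanD n F G : mean n (fun l => F l + G l) = mean n F + mean n G.
Proof.
elim: n F G => [|n IH] F G //=.
by rewrite -big_split /=; apply: eq_bigr => s _; rewrite IH mulrDr.
Qed.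

Lemma meanZ n a F : mean n (fun l => a * F l) = a * mean n F.
Proof.
elim: n F => [|n IH] F //=; rewrite big_distrr /=.
by apply: eq_bigr => s _; rewrite IH mulrCA.
Qed.

Lemma mean_cat m n F :
  mean (m + n) F = mean m (fun x => mean n (fun y => F (x ++ y))).
Proof.
elim: m F => [|m IH] F //=.
by apply: eq_bigr => s _; rewrite IH.
Qed.

Lemma mean_rcons n F :
  mean n.+1 F = \sum_s w s * mean n (fun l => F (rcons l s)).
Proof.
rewrite -addn1 mean_cat /= mean_sum.
apply: eq_bigr => s _; rewrite meanZ; congr (_ * _).
by apply: eq_mean => l _; rewrite cats1.
Qed.

Lemma mean_rev n F : mean n (fun l => F (rev l)) = mean n F.
Proof.
elim: n F => [|n IH] F //=; rewrite -/(mean n.+1 F) mean_rcons.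
apply: eq_bigr => s _; congr (_ * _).
by rewrite -(IH (fun l => F (rcons l s))); apply: eq_mean => l _; rewrite rev_cons.
Qed.

Hypothesis w_ge0 : forall s, 0 <= w s.

(** Words with a letter of weight zero contribute nothing. The degenerate cases and the treatment of
    the difference 0 rely on this. *)
Lemma le_mean_support n F G :
  (forall l, size l = n -> all (fun s => w s != 0) l -> F l <= G l) ->
  mean n F <= mean n G.
Proof.
elim: n F G => [|n IH] F G FG /=; first exact: FG.
apply: ler_sum => s _; have [->|ws] := eqVneq (w s) 0; first by rewrite !mul0r.
apply: ler_wpM2l => //; apply: IH => l sl al; apply: FG => /=; first by rewrite sl.
by rewrite ws.
Qed.

Lemma le_mean n F G : (forall l, size l = n -> F l <= G l) ->
  mean n F <= mean n G.
Proof. by move=> FG; apply: le_mean_support => l sl _; apply: FG. Qed.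

(** Only the term of the word [x] is kept. This is how a prescribed fringe is paid for in the
    positivity argument. *)
Lemma mean_ge_point n F x : (forall l, 0 <= F l) -> size x = n ->
  (\prod_(s <- x) w s) * F x <= mean n F.
Proof.
move=> F0; elim: n x F F0 => [|n IH] [|a x] F F0 //=; first by rewrite big_nil mul1r.
case=> sx; rewrite big_cons (bigD1 a) //= -mulrA ler_wpDr //.
  apply: sumr_ge0 => s _; apply: mulr_ge0 => //.
  (* The word [nseq n a] is arbitrary: any word of length [n] shows that the remaining terms are
     nonnegative. *)
  apply: le_trans (IH (nseq n a) (fun l => F (s :: l)) _ (size_nseq _ _)) => //.
  by apply: mulr_ge0 => //; apply: prodr_ge0.
by apply: ler_wpM2l => //; apply: (IH _ (fun l => F (a :: l))).
Qed.

Hypothesis w_sum1 : \sum_s w s = 1.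

Lemma mean_const n a : mean n (fun=> a) = a.
Proof.
by elim: n => [|n IH] //=; rewrite -big_distrl /= w_sum1 mul1r.
Qed.

Lemma mean_bool_ge0 n (P : pred (seq T)) : 0 <= mean n (fun l => (P l)%:R).
Proof. by rewrite -[leLHS](mean_const n); apply: le_mean => l _; rewrite ler0n. Qed.

Lemma mean_all n (P : pred T) :
  mean n (fun l => (all P l)%:R) = (\sum_(s | P s) w s) ^+ n.
Proof.
elim: n => [|n IH] //=; rewrite exprS big_distrl [RHS]big_mkcond /=.
apply: eq_bigr => s _; case: ifP => Ps; first by rewrite -IH.
by rewrite (mean_const n 0) mulr0.
Qed.

(** The pairs of letters at equal positions of two independent words are independent with a common
    law, whence a power. *)
Lemma mean_zip n (P : pred (T * T)) :
  mean n (fun x => mean n (fun y => (all P (zip x y))%:R))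
    = (\sum_s \sum_(t | P (s, t)) w s * w t) ^+ n.
Proof.
elim: n => [|n IH] //=; rewrite exprS big_distrl; apply: eq_bigr => s _.
rewrite mean_sum big_distrl [RHS]big_mkcond big_distrr /=.
apply: eq_bigr => t _; rewrite meanZ; case: ifP => Pst; first by rewrite /= IH mulrA.
rewrite (_ : mean n _ = 0) ?mulr0 //.
by rewrite -[RHS](mean_const n); apply: eq_mean => x _; rewrite mean_const.
Qed.

End Mean.

(** * Sums and differences as convolutions of words of cells *)

Definition conv (x y : seq (bool * bool)) (k : nat) : bool :=
  has (fun i => (nth (false, false) x i).1 && (nth (false, false) y (k - i)).2)
    (iota 0 k.+1).

Definition conv2 (x y : seq (bool * bool)) (k : nat) : bool :=
  conv x y k || conv y x k.

(* For a configuration [l] of [n + 1] cells, [conv l l k] says that the sum [k]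
   occurs, [conv (rev l) (rev l) k] that [2n - k] occurs, and
   [conv2 l (rev l) k] that [n - k] and [k - n] are differences. *)
Definition mstd (l : seq (bool * bool)) : bool :=
  let n := (size l).-1 in
  ((\sum_(k < n) conv2 l (rev l) k).*2 + conv2 l (rev l) n
   < \sum_(k < n) (conv l l k + conv (rev l) (rev l) k) + conv l l n)%N.

Lemma convP (x y : seq (bool * bool)) k :
  reflect (exists i j, [/\ (i + j = k)%N, (nth (false, false) x i).1
                         & (nth (false, false) y j).2]) (conv x y k).
Proof.
apply: (iffP hasP) => [[i]|[i [j [ijk xi yj]]]].
  rewrite mem_iota => ik /andP[xi yj]; exists i, (k - i)%N; split => //; lia.
exists i; first by rewrite mem_iota; lia.
by rewrite xi (_ : k - i = j)%N //; lia.
Qed.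

Section Cardinality.
Variables (n : nat) (A B : {set 'I_n.+1}) (l : seq (bool * bool)).
Hypothesis sz_l : size l = n.+1.
Hypothesis nth_l : forall i : 'I_n.+1,
  nth (false, false) l i = (i \in A, i \in B).

Lemma mem_int_set (C : {set 'I_n.+1}) x :
  reflect (exists2 i : 'I_n.+1, i \in C & x = (i : nat)%:Z) (x \in int_set C).
Proof.
apply: (iffP (imfsetP _ _ _ _)) => /= -[i iC ->]; exists i => //.
Qed.

Lemma int_setAP x : reflect
  (exists2 i : nat, (nth (false, false) l i).1 & x = i%:Z) (x \in int_set A).
Proof.
apply: (iffP (mem_int_set _ _)) => -[i iA ->].
  by exists i => //; rewrite nth_l.
case: (ltnP i n.+1) => [lt_in|le_ni].
  exists (Ordinal lt_in) => //; move: iA.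
  by rewrite -[i]/(nat_of_ord (Ordinal lt_in)) nth_l.
by move: iA; rewrite nth_default // sz_l.
Qed.

Lemma int_setBP x : reflect
  (exists2 i : nat, (nth (false, false) l i).2 & x = i%:Z) (x \in int_set B).
Proof.
apply: (iffP (mem_int_set _ _)) => -[i iA ->].
  by exists i => //; rewrite nth_l.
case: (ltnP i n.+1) => [lt_in|le_ni].
  exists (Ordinal lt_in) => //; move: iA.
  by rewrite -[i]/(nat_of_ord (Ordinal lt_in)) nth_l.
by move: iA; rewrite nth_default // sz_l.
Qed.

(** The default cell lies in neither set, so a cell accepted by [f] cannot come from outside the
    word. *)
Lemma nth_lt (f : bool * bool -> bool) i : f (false, false) = false ->
  f (nth (false, false) l i) -> (i <= n)%N.
Proof.
move=> f0; case: (leqP i n) => // ni.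
by rewrite nth_default ?sz_l // f0.
Qed.

Lemma sumsetP x : reflect
  (exists i j, [/\ (i <= n)%N, (j <= n)%N, (nth (false, false) l i).1,
     (nth (false, false) l j).2 & x = (i + j)%N%:Z])
  (x \in sumset (int_set A) (int_set B)).
Proof.
apply: (iffP (imfset2P _ _ _ _ _)) => /=.
  move=> [a /int_setAP[i iA ->]] [b /int_setBP[j jB ->]] ->.
  exists i, j; split => //.
    exact: (@nth_lt fst).
  exact: (@nth_lt snd).
move=> [i [j [_ _ iA jB ->]]].
exists i%:Z; first by apply/int_setAP; exists i.
by exists j%:Z => //; apply/int_setBP; exists j.
Qed.

Lemma pmdiffsetP x : reflect
  (exists i j, [/\ (i <= n)%N, (j <= n)%N, (nth (false, false) l i).1,
     (nth (false, false) l j).2 & x = i%:Z - j%:Z \/ x = j%:Z - i%:Z])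
  (x \in pmdiffset (int_set A) (int_set B)).
Proof.
rewrite in_fsetU; apply: (iffP orP).
  case=> /imfset2P /=.
    move=> [a /int_setAP[i iA ->]] [b /int_setBP[j jB ->]] ->.
    exists i, j; split => //; [exact: (@nth_lt fst)|exact: (@nth_lt snd)|by left].
  move=> [b /int_setBP[j jB ->]] [a /int_setAP[i iA ->]] ->.
  exists i, j; split => //; [exact: (@nth_lt fst)|exact: (@nth_lt snd)|by right].
move=> [i [j [_ _ iA jB [->|->]]]]; [left|right]; apply/imfset2P.
  exists i%:Z; first by apply/int_setAP; exists i.
  by exists j%:Z => //; apply/int_setBP; exists j.
exists j%:Z; first by apply/int_setBP; exists j.
by exists i%:Z => //; apply/int_setAP; exists i.
Qed.

Lemma nth_rev_l i : (i <= n)%N ->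
  nth (false, false) (rev l) i = nth (false, false) l (n - i).
Proof. by move=> i_n; rewrite nth_rev sz_l // subSS. Qed.

Lemma nth_rev_lt (f : bool * bool -> bool) i : f (false, false) = false ->
  f (nth (false, false) (rev l) i) -> (i <= n)%N.
Proof.
move=> f0; case: (leqP i n) => // ni.
by rewrite nth_default ?size_rev ?sz_l // f0.
Qed.

Lemma mem_sumset k : (k%:Z \in sumset (int_set A) (int_set B)) = conv l l k.
Proof.
apply/sumsetP/convP => [[i [j [_ _ iA jB ijk]]]|[i [j [ijk iA jB]]]]; exists i, j.
  by split => //; lia.
by split=> //; [exact: (@nth_lt fst)|exact: (@nth_lt snd)|rewrite ijk].
Qed.

Lemma mem_sumset_rev k : (k <= n)%N ->
  ((n + n - k)%N%:Z \in sumset (int_set A) (int_set B))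
    = conv (rev l) (rev l) k.
Proof.
move=> kn; apply/sumsetP/convP => [[i [j [i_n jn iA jB ijk]]]|[i [j [ijk iA jB]]]].
  exists (n - i)%N, (n - j)%N; split; first lia.
    by rewrite nth_rev_l ?leq_subr // subKn.
  by rewrite nth_rev_l ?leq_subr // subKn.
have i_n := @nth_rev_lt fst _ erefl iA; have jn := @nth_rev_lt snd _ erefl jB.
exists (n - i)%N, (n - j)%N; rewrite -!nth_rev_l ?leq_subr //; split => //; lia.
Qed.

(** Reversing one word turns differences into sums: [i - j = n - k] iff [(n - i) + j = k]. The other
    order in [conv2] accounts for [j - i = n - k]. *)
Lemma mem_pmdiffset (x : int) (k : nat) : (k <= n)%N ->
  x = (n - k)%N%:Z \/ x = - (n - k)%N%:Z ->
  (x \in pmdiffset (int_set A) (int_set B)) = conv2 l (rev l) k.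
Proof.
move=> kn xk; apply/pmdiffsetP/orP.
  move=> [i [j [i_n jn iA jB xij]]].
  have [ij|ij] : (j + (n - k) = i)%N \/ (i + (n - k) = j)%N.
  - by case: xk xij => -> [] ?; lia.
  - right; apply/convP; exists (n - i)%N, j; rewrite nth_rev_l ?subKn //; last lia.
    by split=> //; lia.
  - left; apply/convP; exists i, (n - j)%N; rewrite nth_rev_l ?subKn //; last lia.
    by split=> //; lia.
case=> /convP[i [j [ijk iA jB]]].
- have i_n := @nth_lt fst _ erefl iA; have jn := @nth_rev_lt snd _ erefl jB.
  exists i, (n - j)%N; rewrite -nth_rev_l //; split => //; first lia.
  by case: xk => ->; [right|left]; lia.
- have i_n := @nth_rev_lt fst _ erefl iA; have jn := @nth_lt snd _ erefl jB.
  exists (n - i)%N, j; rewrite -nth_rev_l //; split => //; first lia.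
  by case: xk => ->; [left|right]; lia.
Qed.

Lemma card_fset_int (X : {fset int}) (g : nat -> int) m : injective g ->
  (forall x, x \in X -> exists2 k, (k < m)%N & x = g k) ->
  #|` X| = (\sum_(k < m) (g k \in X))%N.
Proof.
move=> g_inj Xg; transitivity (count (mem X) (map g (iota 0 m))); last first.
  rewrite -(big_mkord xpredT (fun k => nat_of_bool (g k \in X))) /index_iota subn0.
  by rewrite count_map -sum1_count big_mkcond; apply: eq_bigr => k _ /=; case: (_ \in _).
rewrite -size_filter; apply: perm_size; apply: uniq_perm.
- exact: fset_uniq.
- by rewrite filter_uniq // map_inj_uniq ?iota_uniq.
move=> x; rewrite mem_filter /=; case xX: (x \in X); rewrite ?andbF //=.
by have [k km ->] := Xg _ xX; rewrite map_f // mem_iota.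
Qed.

Lemma sum_fold (T : nat -> nat) m :
  (\sum_(k < m + m.+1) T k = \sum_(k < m) (T k + T (m + m - k)) + T m)%N.
Proof.
rewrite big_split_ord /= big_ord_recl /= addn0 big_split /= -!addnA; congr (_ + _)%N.
rewrite addnC; congr (_ + _)%N.
rewrite (reindex_inj rev_ord_inj) /=; apply: eq_bigr => i _; congr (T _).
rewrite /bump leq0n /= ; have := ltn_ord i; lia.
Qed.

Lemma MSTD_pair_mstd : MSTD_pair (int_set A) (int_set B) = mstd l.
Proof.
rewrite /MSTD_pair /mstd sz_l /=; congr (_ < _)%N.
  (* Differences lie in [[-n, n]]; the shift by [n] indexes them by [2n + 1] values, just like the
     sums in [[0, 2n]]. After folding, symmetry gives the doubled term of [mstd]. *)
  rewrite (@card_fset_int _ (fun k => k%:Z - n%:Z) (n + n.+1)).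
  - rewrite (sum_fold (fun k => nat_of_bool (k%:Z - n%:Z \in _))).
    congr (_ + _)%N; last by rewrite (@mem_pmdiffset _ n) //; left; lia.
    rewrite -muln2 big_distrl /=; apply: eq_bigr => k _.
    have kn := ltn_ord k.
    rewrite (@mem_pmdiffset (k%:Z - _) k); [|lia|right; lia].
    by rewrite (@mem_pmdiffset _ k) ?muln2 ?addnn //; [lia|left; lia].
  - by move=> i j /=; lia.
  - move=> x /pmdiffsetP[i [j [i_n jn _ _ [->|->]]]].
      by exists (n + i - j)%N; lia.
    by exists (n + j - i)%N; lia.
rewrite (@card_fset_int _ (fun k => k%:Z) (n + n.+1)).
- rewrite (sum_fold (fun k => nat_of_bool (k%:Z \in _))).
  congr (_ + _)%N; last by rewrite mem_sumset.
  apply: eq_bigr => k _.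
  by rewrite mem_sumset mem_sumset_rev //; have := ltn_ord k; lia.
- by move=> i j /=; lia.
- move=> x /sumsetP[i [j [i_n jn _ _ ->]]].
  by exists (i + j)%N => //; lia.
Qed.

End Cardinality.

(** * Transfer of the probability to random words *)

Definition cell_weight (R : realType) (p rho1 rho2 : R) (s : bool * bool) : R :=
  elt_weight p rho1 rho2 s.1 s.2.

Lemma mean_tuple (R : realDomainType) (T : finType) (w : T -> R) n F :
  \sum_(t : n.-tuple T) (\prod_(i < n) w (tnth t i)) * F (val t) = mean w n F.
Proof.
elim: n F => [|n IH] F /=.
  rewrite (big_pred1 [tuple]) => [|t]; rewrite ?big_ord0 ?mul1r //.
  by rewrite [t]tuple0; apply/esym/eqP.
rewrite (reindex (fun st : T * n.-tuple T => [tuple of st.1 :: st.2])) /=; last first.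
  exists (fun t : n.+1.-tuple T => (thead t, [tuple of behead t])).
    by case=> s t _; congr (_, _); apply: val_inj.
  by move=> t _; rewrite /= -tuple_eta.
rewrite -(pair_bigA _ (fun (s : T) (t : n.-tuple T) =>
  (\prod_(i < n.+1) w (tnth [tuple of s :: t] i)) * F (s :: t))) /=.
apply: eq_bigr => s _; rewrite -IH big_distrr /=; apply: eq_bigr => t _.
rewrite big_ord_recl mulrA tnth0; congr (_ * _ * _).
by apply: eq_bigr => i _; rewrite tnthS.
Qed.

Lemma MSTD_prob_mean (R : realType) (p rho1 rho2 : R) n :
  MSTD_prob p rho1 rho2 n
    = mean (cell_weight p rho1 rho2) n.+1 (fun l => (mstd l)%:R).
Proof.
rewrite -mean_tuple /MSTD_prob /correlated_prob big_mkcond /=.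
pose f (t : n.+1.-tuple (bool * bool)) : {set 'I_n.+1} * {set 'I_n.+1} :=
  ([set i | (tnth t i).1]%SET, [set i | (tnth t i).2]%SET).
rewrite (reindex f) /=; last first.
  exists (fun AB : {set 'I_n.+1} * {set 'I_n.+1} =>
    [tuple (i \in AB.1, i \in AB.2) | i < n.+1]).
    by move=> t _; apply: eq_from_tnth => i; rewrite tnth_mktuple !inE; case: (tnth t i).
  by case=> A B _; congr (_, _); apply/setP => i; rewrite !inE tnth_mktuple.
apply: eq_bigr => t _.
rewrite (@MSTD_pair_mstd _ _ _ t) ?size_tuple //; last first.
  by move=> i; rewrite -tnth_nth !inE; case: (tnth t i).
case: mstd; rewrite ?mulr1 ?mulr0 //.
by apply: eq_bigr => i _; rewrite /cell_weight !inE.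
Qed.

(** * Exponential decay of the probability that a value is missing *)

Lemma drop_zip (S T : Type) n (s : seq S) (t : seq T) :
  drop n (zip s t) = zip (drop n s) (drop n t).
Proof.
by elim: n s t => [|n IH] [|a s] [|b t] //=; rewrite ?IH //; case: (drop n _).
Qed.

Lemma all_drop (T : Type) (P : pred T) n s : all P s -> all P (drop n s).
Proof. by rewrite -{1}(cat_take_drop n s) all_cat => /andP[]. Qed.

Section Estimates.
Variables (R : realFieldType) (w : bool * bool -> R).
Hypothesis w_ge0 : forall s, 0 <= w s.
Hypothesis w_sum1 : \sum_s w s = 1.
Variable t : R.
Hypothesis t_ge0 : 0 <= t.
Hypothesis t_lt1 : t < 1.

Local Notation missed :=
  (fun st : (bool * bool) * (bool * bool) => ~~ (st.1.1 && st.2.2)).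

(** The probability that two independent cells fail to give an element of [A] in the first and of
    [B] in the second. The bound [t ^+ 2] below charges one factor [t] to each cell. *)
Let c := \sum_s \sum_(u | missed (s, u)) w s * w u.
Hypothesis c_le : c <= t ^+ 2.

Lemma mean_bool_le1 n (P : pred (seq (bool * bool))) :
  mean w n (fun l => (P l)%:R) <= 1.
Proof.
rewrite -[leRHS](mean_const w_sum1 n); apply: le_mean => // l _.
by rewrite lern1 leq_b1.
Qed.

Let c_ge0 : 0 <= c.
Proof. by apply: sumr_ge0 => s _; apply: sumr_ge0 => u _; apply: mulr_ge0. Qed.

Let t_le1 : t <= 1. Proof. exact: ltW. Qed.

Lemma le_bool (a b : bool) : (a -> b) -> a%:R <= b%:R :> R.
Proof. by case: a b => [] [] // H; rewrite ?ler01 ?lexx //; have := H isT. Qed.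

Lemma expr_c_le h k : (k <= h.*2)%N -> c ^+ h <= t ^+ k.
Proof.
move=> kh; apply: (@le_trans _ _ ((t ^+ 2) ^+ h)).
  by apply: lerXn2r; rewrite ?nnegrE ?exprn_ge0.
by rewrite -exprM mul2n; apply: ler_wiXn2l.
Qed.

(* With [N >= 2d], the first [2d] cells carry [d] disjoint pairs at distance [d],
   and the remaining [N - 2d] cells are treated by induction. *)
Lemma mean_no_shift N d : (0 < d)%N ->
  mean w N (fun l => (all missed (zip l (drop d l)))%:R) <= t ^+ (N - d).
Proof.
move=> d0; elim/ltn_ind: N => N IH.
have [Nd|dN] := ltnP N d.
  by rewrite (eqP (ltnW Nd)) expr0; apply: mean_bool_le1.
(* For [d <= N < 2d] the pairs at distance [d] are already disjoint: they match the first [N - d]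
   cells with the last [N - d] ones. *)
have [N2d|d2N] := ltnP N d.*2.
  have eN : N = (N - d + ((d.*2 - N) + (N - d)))%N by lia.
  rewrite {1}eN mean_cat.
  apply: (@le_trans _ _ (c ^+ (N - d))); last by apply: expr_c_le; lia.
  rewrite /c -(mean_zip w_sum1 _ missed); apply: le_mean => // x sx; rewrite mean_cat.
  set K := mean w (N - d) _; rewrite -[leRHS](mean_const w_sum1 (d.*2 - N)).
  apply: le_mean => // y sy; apply: le_mean => // z sz; apply: le_bool.
  rewrite catA drop_size_cat ?size_cat ?sx ?sy; last lia.
  by rewrite -catA -{2}[z]cats0 zip_cat ?sx ?sz // all_cat => /andP[].
have eN : N = (d + (d + (N - d.*2)))%N by lia.
rewrite {1}eN mean_cat.
(* The subtraction is truncated when [N < 3d], but then the exponent [2d] alone exceeds [N - d]. *)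
apply: (@le_trans _ _ (c ^+ d * t ^+ (N - d.*2 - d))); last first.
  apply: (@le_trans _ _ (t ^+ d.*2 * t ^+ (N - d.*2 - d))).
    by apply: ler_wpM2r; [exact: exprn_ge0|exact: expr_c_le].
  by rewrite -exprD; apply: ler_wiXn2l => //; lia.
rewrite mulrC /c -(mean_zip w_sum1 _ missed) -meanZ; apply: le_mean => // x sx.
rewrite -meanZ mean_cat; apply: le_mean => // z sz.
rewrite mulrC; apply: (@le_trans _ _ ((all missed (zip x z))%:R *
  mean w (N - d.*2) (fun l => (all missed (zip l (drop d l)))%:R))); last first.
  by apply: ler_wpM2l => //; apply: IH; lia.
rewrite -meanZ; apply: le_mean => // l sl; rewrite -natrM mulnb; apply: le_bool.
rewrite drop_size_cat // zip_cat ?sx ?sz // all_cat => /andP[-> /(all_drop d)].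
by rewrite drop_zip drop_size_cat.
Qed.

(** The [h] pairs [(i, k - i)] with [i < h] are disjoint, the middle cell being left out for even
    [k], and [2h >= k]. *)
Lemma mean_no_sum N k : (k < N)%N ->
  mean w N (fun l => (~~ conv l l k)%:R) <= t ^+ k.
Proof.
move=> kN; pose h := k.+1./2.
have hE := odd_double_half k.+1; rewrite -/h in hE.
have hk : (h.*2 <= k.+1)%N by lia.
have eN : N = (h + ((k.+1 - h.*2) + (h + (N - k.+1))))%N by lia.
rewrite {1}eN mean_cat.
apply: (@le_trans _ _ (c ^+ h)); last first.
  by apply: expr_c_le; move: hE; case: odd; lia.
rewrite /c -(mean_zip w_sum1 _ missed); apply: le_mean => // x sx; rewrite mean_cat.
set K := mean w h _; rewrite -[leRHS](mean_const w_sum1 (k.+1 - h.*2)).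
(* The pairs are nested, so the second block is reversed, which preserves its law, to bring them to
   equal positions. *)
apply: le_mean => // y sy; rewrite mean_cat /K -[leRHS]mean_rev.
apply: le_mean => // z sz; rewrite -[leRHS](mean_const w_sum1 (N - k.+1)).
apply: le_mean => // r sr; apply: le_bool; move=> /negP no_k.
apply/(all_nthP ((false, false), (false, false))) => i.
rewrite size_zip size_rev sx sz minnn => lt_i; apply/negP.
rewrite nth_zip ?size_rev ?sx ?sz // nth_rev ?sz //= => /andP[xi zi].
apply: no_k; apply/convP; exists i, (k - i)%N; split; first lia.
  by rewrite nth_cat sx lt_i.
rewrite nth_cat sx ifF; last lia.
rewrite nth_cat sy ifF; last lia.
rewrite nth_cat sz ifT; last lia.
by rewrite (_ : k - i - h - (k.+1 - h.*2) = h - i.+1)%N //; lia.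
Qed.

(** A missing [k] forbids all pairs at distance [n - k], which is positive since [k < n], so
    [mean_no_shift] applies. *)
Lemma mean_no_diff n k : (k < n)%N ->
  mean w n.+1 (fun l => (~~ conv l (rev l) k)%:R) <= t ^+ k.
Proof.
move=> kn; apply: (@le_trans _ _ (t ^+ (n.+1 - (n - k)))); last first.
  by apply: ler_wiXn2l => //; lia.
have nk0 : (0 < n - k)%N by lia.
apply: le_trans (mean_no_shift n.+1 nk0); apply: le_mean => // l sl; apply: le_bool.
move=> /negP no_k.
apply/(all_nthP ((false, false), (false, false))) => i lt_i; apply/negP.
rewrite nth_zip_cond lt_i; move: lt_i; rewrite size_zip size_drop sl => lt_i.
rewrite nth_drop /= => /andP[li ri].
apply: no_k; apply/convP; exists i, (k - i)%N; split => //; first lia.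
rewrite nth_rev sl; last lia.
by rewrite (_ : n.+1 - (k - i).+1 = n - k + i)%N //; lia.
Qed.

Lemma sum_geom_le m j : \sum_(k <- iota m j) t ^+ k <= t ^+ m / (1 - t).
Proof.
have t1 : 0 < 1 - t by rewrite subr_gt0.
elim: j m => [|j IH] m /=.
  by rewrite big_nil; apply: divr_ge0; [exact: exprn_ge0|exact: ltW].
rewrite big_cons; apply: (@le_trans _ _ (t ^+ m + t ^+ m.+1 / (1 - t))).
  by rewrite lerD2l.
rewrite exprS le_eqVlt; apply/orP; left; apply/eqP; field; lra.
Qed.

(** Union bound, then a geometric series. *)
Lemma mean_not_all N m j (Q : seq (bool * bool) -> nat -> bool) :
  (forall k, (m <= k < m + j)%N -> mean w N (fun l => (~~ Q l k)%:R) <= t ^+ k) ->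
  mean w N (fun l => (~~ all (Q l) (iota m j))%:R) <= t ^+ m / (1 - t).
Proof.
move=> HQ; apply: le_trans (sum_geom_le m j).
apply: (@le_trans _ _ (mean w N (fun l => \sum_(k <- iota m j) (~~ Q l k)%:R))).
  apply: le_mean => // l _; elim: (iota m j) => [|k s IH] /=; first by rewrite big_nil.
  rewrite big_cons negb_and; case: (Q l k) => /=; first by rewrite add0r.
  by rewrite lerDl; apply: sumr_ge0.
rewrite mean_sum big_seq [leRHS]big_seq; apply: ler_sum => k.
by rewrite mem_iota => /HQ.
Qed.

Definition sums_from m (l : seq (bool * bool)) :=
  all (conv l l) (iota m (size l - m)).

(** The range stops before [k = (size l).-1], the difference 0, which can be missing with
    probability 1 and is treated apart. *)
Definition diffs_from m (l : seq (bool * bool)) :=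
  all (conv l (rev l)) (iota m ((size l).-1 - m)).

Lemma mean_not_sums_from N m :
  mean w N (fun l => (~~ sums_from m l)%:R) <= t ^+ m / (1 - t).
Proof.
apply: le_trans (@mean_not_all N m (N - m) (fun l => conv l l) _).
  by apply: le_mean => // l sl; rewrite /sums_from sl.
by move=> k kN; apply: mean_no_sum; lia.
Qed.

Lemma mean_not_sums_from_rev N m :
  mean w N (fun l => (~~ sums_from m (rev l))%:R) <= t ^+ m / (1 - t).
Proof.
by rewrite (mean_rev _ _ (fun l => (~~ sums_from m l)%:R)); apply: mean_not_sums_from.
Qed.

Lemma mean_not_diffs_from n m :
  mean w n.+1 (fun l => (~~ diffs_from m l)%:R) <= t ^+ m / (1 - t).
Proof.
apply: le_trans (@mean_not_all n.+1 m (n - m) (fun l => conv l (rev l)) _).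
  by apply: le_mean => // l sl; rewrite /diffs_from sl.
by move=> k kN; apply: mean_no_diff; lia.
Qed.

End Estimates.

(** * Reduction of sum-dominance to the two fringes *)

Lemma conv_take m x y k : (k < m)%N -> conv (take m x) (take m y) k = conv x y k.
Proof.
move=> km; apply: eq_in_has => i; rewrite mem_iota => ik.
by rewrite !nth_take //; lia.
Qed.

Lemma sum_const_tail (T : nat -> nat) a m n : (m <= n)%N ->
  (forall k, (m <= k < n)%N -> T k = a) ->
  (\sum_(k < n) T k = \sum_(k < m) T k + (n - m) * a)%N.
Proof.
move=> mn Ta; rewrite -!(big_mkord xpredT T) (big_cat_nat _ (n := m)) //=.
by congr (_ + _)%N; rewrite (eq_big_nat _ _ Ta) sum_nat_const_nat.
Qed.

Lemma sums_fromP m l k : sums_from m l -> (m <= k < size l)%N -> conv l l k.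
Proof. by move=> /allP H mk; apply: H; rewrite mem_iota; lia. Qed.

Lemma diffs_fromP m l k : diffs_from m l -> (m <= k < (size l).-1)%N ->
  conv l (rev l) k.
Proof. by move=> /allP H mk; apply: H; rewrite mem_iota; lia. Qed.

Lemma count_sums n m l : size l = n.+1 -> (m <= n)%N ->
  sums_from m l -> sums_from m (rev l) ->
  (\sum_(k < n) (conv l l k + conv (rev l) (rev l) k) + conv l l n
   = \sum_(k < m) (conv l l k + conv (rev l) (rev l) k) + (n - m).*2.+1)%N.
Proof.
move=> sl mn Hl Hr.
rewrite (@sum_const_tail (fun k => conv l l k + conv (rev l) (rev l) k)%N 2%N m) //.
  by rewrite (sums_fromP Hl) ?sl ?mn //; lia.
move=> k kn; rewrite (sums_fromP Hl) ?sl; last lia.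
by rewrite (sums_fromP Hr) ?size_rev ?sl //; lia.
Qed.

(** Here [x] is the left end and [y] the right end read backwards. The bit [z] tells whether 0 is a
    difference and the successor counts the central sum [n]; the [2(n - m)] other values cancel
    between the two sides. *)
Definition fringe_mstd (z : bool) m (x y : seq (bool * bool)) : bool :=
  ((\sum_(k < m) conv2 x y k).*2 + z
   < (\sum_(k < m) (conv x x k + conv y y k)).+1)%N.

Lemma fringe_mstd_take z m x y :
  fringe_mstd z m (take m x) (take m y) = fringe_mstd z m x y.
Proof.
congr ((_.*2 + z < _.+1)%N); apply: eq_bigr => k _.
  by rewrite /conv2 !conv_take.
by rewrite !conv_take.
Qed.

Lemma mstd_fringe z n m l : size l = n.+1 -> (m <= n)%N ->
  sums_from m l -> sums_from m (rev l) -> diffs_from m l ->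
  conv2 l (rev l) n = z ->
  mstd l = fringe_mstd z m (take m l) (take m (rev l)).
Proof.
move=> sl mn Hl Hr Hd Hz; rewrite /mstd sl /= (count_sums sl mn) // Hz.
rewrite (@sum_const_tail (fun k => nat_of_bool (conv2 l (rev l) k)) 1%N m) //; last first.
  by move=> k kn; rewrite /conv2 (diffs_fromP Hd) ?sl.
by rewrite fringe_mstd_take /fringe_mstd muln1; lia.
Qed.

(* For positivity the differences need not be controlled beyond the fringe:
   there each of them is at most counted once. *)
Lemma mstd_of_fringe n m l : size l = n.+1 -> (m <= n)%N ->
  sums_from m l -> sums_from m (rev l) ->
  fringe_mstd true m (take m l) (take m (rev l)) -> mstd l.
Proof.
move=> sl mn Hl Hr; rewrite /mstd sl /= (count_sums sl mn) //.
rewrite fringe_mstd_take /fringe_mstd.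
have : (\sum_(k < n) conv2 l (rev l) k <= \sum_(k < m) conv2 l (rev l) k + (n - m))%N.
  rewrite -!(big_mkord xpredT (fun k => nat_of_bool (conv2 l (rev l) k))).
  rewrite (big_cat_nat _ (n := m)) //= leq_add2l -[leqRHS]muln1 -sum_nat_const_nat.
  by apply: leq_sum => k _; apply: leq_b1.
set a := (\sum_(k < n) _)%N; set b := (\sum_(k < m) conv2 _ _ _)%N.
set d := (\sum_(k < m) _)%N.
by case: (conv2 l (rev l) n); lia.
Qed.

(** * Convergence of the probabilities *)

Section Limit.
Variables (R : realFieldType) (w : bool * bool -> R).
Hypothesis w_ge0 : forall s, 0 <= w s.
Hypothesis w_sum1 : \sum_s w s = 1.

Lemma mean_dist n (P Q B : pred (seq (bool * bool))) :
  (forall l, size l = n -> all (fun s => w s != 0) l -> ~~ B l -> P l = Q l) ->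
  `|mean w n (fun l => (P l)%:R) - mean w n (fun l => (Q l)%:R)|
    <= mean w n (fun l => (B l)%:R).
Proof.
move=> PQ; rewrite ler_distlC lerBlDr -!meanD; apply/andP; split.
  apply: le_mean_support => // l sl al; have := PQ l sl al.
  by case: (B l) (P l) (Q l) => [] [] [] //= H; rewrite -?natrD ?ler_nat //; have := H isT.
apply: le_mean_support => // l sl al; have := PQ l sl al.
by case: (B l) (P l) (Q l) => [] [] [] //= H; rewrite -?natrD ?ler_nat //; have := H isT.
Qed.

(** As [2m <= N], the two ends do not overlap, hence are independent, and reversal preserves the law
    of the right one. *)
Lemma mean_take_rev m N (F : seq (bool * bool) -> seq (bool * bool) -> R) :
  (m.*2 <= N)%N ->
  mean w N (fun l => F (take m l) (take m (rev l)))
    = mean w m (fun x => mean w m (fun y => F x y)).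
Proof.
move=> mN; have -> : N = (m + ((N - m.*2) + m))%N by lia.
rewrite mean_cat; apply: eq_mean => x sx; rewrite mean_cat.
rewrite -[RHS](mean_const w_sum1 (N - m.*2)); apply: eq_mean => y _.
rewrite -[RHS]mean_rev; apply: eq_mean => z sz.
by rewrite take_size_cat // catA rev_cat take_size_cat ?size_rev.
Qed.

Let z := w (true, true) != 0.

Variable t : R.
Hypothesis t_ge0 : 0 <= t.
Hypothesis t_lt1 : t < 1.
Hypothesis c_le : \sum_s \sum_(u | ~~ (s.1 && u.2)) w s * w u <= t ^+ 2.
Hypothesis z_le : z -> 1 - w (true, true) <= t.

(** The difference 0 occurs iff some cell lies in both sets. Such cells either have weight zero, or
    are avoided with probability [(1 - w (true, true)) ^+ n.+1]. *)
Lemma mean_diff0 n :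
  mean w n.+1 (fun l => (conv2 l (rev l) n != z)%:R) <= t ^+ n.+1.
Proof.
have conv2E l : size l = n.+1 -> conv2 l (rev l) n = has (fun s => s.1 && s.2) l.
  move=> sl; apply/orP/(has_nthP (false, false)).
    case=> /convP[i [j [ij]]].
      rewrite nth_rev sl; last lia.
      by rewrite (_ : n.+1 - j.+1 = i)%N => [li ri|]; [exists i; [lia|apply/andP]|lia].
    rewrite nth_rev sl; last lia.
    by rewrite (_ : n.+1 - i.+1 = j)%N => [li ri|]; [exists j; [lia|apply/andP]|lia].
  rewrite sl => -[i lti /andP[li ri]]; left; apply/convP; exists i, (n - i)%N.
  rewrite nth_rev sl; last lia.
  by rewrite (_ : n.+1 - (n - i).+1 = i)%N; [split=> //; lia|lia].
have [z0|z0] := boolP z.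
  rewrite (@eq_mean _ _ _ _ _
    (fun l => (all (fun s => ~~ (s.1 && s.2)) l)%:R)); last first.
    by move=> l sl; rewrite conv2E // ?eqb_id -?all_predC.
  rewrite mean_all //; apply: lerXn2r; rewrite ?nnegrE ?sumr_ge0 //.
  apply: le_trans (z_le z0).
  rewrite -w_sum1 [leRHS]addrC [X in _ <= _ + X](bigD1 (true, true)) //= addKr.
  by rewrite le_eqVlt; apply/orP; left; apply/eqP; apply: eq_bigl => -[[] []].
apply: le_trans (exprn_ge0 _ t_ge0); rewrite -[leRHS](mean_const w_sum1 n.+1).
apply: le_mean_support => // l sl /allP al; rewrite conv2E //.
have -> : has (fun s => s.1 && s.2) l = false; last by rewrite eqxx.
apply/hasP => -[[[] []] // /al]; move: z0; rewrite negbK => /eqP ->.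
by rewrite eqxx.
Qed.

(** Low sums, high sums and nonzero differences each cost a geometric series; the difference 0 costs
    the last [t ^+ m]. *)
Lemma mean_mstd_approx n m : (m.*2 <= n)%N ->
  `|mean w n.+1 (fun l => (mstd l)%:R)
    - mean w m (fun x => mean w m (fun y => (fringe_mstd z m x y)%:R))|
  <= t ^+ m * (3 / (1 - t) + 1).
Proof.
move=> mn; rewrite -(@mean_take_rev m n.+1 (fun x y => (fringe_mstd z m x y)%:R));
  last lia.
pose bad l := [|| ~~ sums_from m l, ~~ sums_from m (rev l), ~~ diffs_from m l
  | conv2 l (rev l) n != z].
apply: le_trans (@mean_dist _ _ _ bad _) _.
  move=> l sl _; rewrite /bad !negb_or !negbK => /and4P[? ? ? /eqP ?].
  by apply: (@mstd_fringe _ n) => //; lia.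
apply: (@le_trans _ _ (mean w n.+1 (fun l =>
  ((~~ sums_from m l)%:R + (~~ sums_from m (rev l))%:R) + ((~~ diffs_from m l)%:R
   + (conv2 l (rev l) n != z)%:R)))).
  apply: le_mean => // l sl; rewrite /bad -!natrD ler_nat.
  by do 4!case: (~~ _).
rewrite !meanD.
have h1 := mean_not_sums_from w_ge0 w_sum1 t_ge0 t_lt1 c_le n.+1 m.
have h2 := mean_not_sums_from_rev w_ge0 w_sum1 t_ge0 t_lt1 c_le n.+1 m.
have h3 := mean_not_diffs_from w_ge0 w_sum1 t_ge0 t_lt1 c_le n m.
have h4 := mean_diff0 n.
have h5 : t ^+ n.+1 <= t ^+ m by apply: ler_wiXn2l => //; [exact: ltW|lia].
rewrite (_ : _ * _ = (t ^+ m / (1 - t) + t ^+ m / (1 - t)) + (t ^+ m / (1 - t) + t ^+ m)).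
  by apply: lerD; apply: lerD => //; apply: le_trans h5.
by field; rewrite subr_eq0 gt_eqF.
Qed.

End Limit.

Lemma expr_small (R : realType) (t C e : R) : 0 <= t < 1 -> 0 < e ->
  exists m, t ^+ m * C < e.
Proof.
move=> /andP[t0 t1] e0.
have : (fun m => t ^+ m * C) @ \oo --> (0 * C).
  by apply: cvgMr_tmp; apply: cvg_expr; rewrite ger0_norm.
rewrite mul0r => /cvgr0_norm_lt /(_ e e0) [m _ Hm].
by exists m; apply: le_lt_trans (ler_norm _) (Hm m (leqnn m)).
Qed.

(** Since [L m] does not depend on [n], the tail of [u] stays in a small ball around it, so [u] is
    Cauchy. *)
Lemma is_cvg_approx (R : realType) (u L : nat -> R) (t C : R) : 0 <= t < 1 ->
  (forall m n, (m.*2 <= n)%N -> `|u n - L m| <= t ^+ m * C) ->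
  cvgn u.
Proof.
move=> t01 uL; apply: cauchy_cvg; apply: cauchy_exP => e e0.
have [m Hm] := expr_small C t01 e0; exists (L m); exists m.*2 => // n /= mn.
by rewrite -ball_normE /= distrC; apply: le_lt_trans (uL m n mn) Hm.
Qed.

(** * Prescribed fringes that force sum-dominance *)

Definition swap (s : bool * bool) : bool * bool := (s.2, s.1).

Lemma swapK : involutive swap. Proof. by case. Qed.

Lemma nth_map_swap l i :
  nth (false, false) (map swap l) i = swap (nth (false, false) l i).
Proof.
have [il|li] := ltnP i (size l); first by rewrite (nth_map (false, false)).
by rewrite !nth_default ?size_map.
Qed.

Lemma conv_swap x y k : conv (map swap x) (map swap y) k = conv y x k.
Proof.
apply/convP/convP => -[i [j [ijk]]]; rewrite ?nth_map_swap /= => xi yj;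
  by exists j, i; rewrite ?nth_map_swap; split=> //; lia.
Qed.

(** Exchanging [A] and [B] keeps the sums. Together with reversal this lets the right end be handled
    as a left end. *)
Lemma sums_from_swap m l : sums_from m (map swap l) = sums_from m l.
Proof. by rewrite /sums_from size_map; apply: eq_all => k; apply: conv_swap. Qed.

(** The letter [sB] is meant to lie in [B] and [sA] in [A]; their other components stay free because
    the two positivity cases use different letters. *)
Definition fringe (core : seq (bool * bool)) b sB sA :=
  core ++ (nseq b sB ++ nseq b sA).

(* Adding one element of [A] (resp. [B]) to the block [c, c + b) contained in [B]
   (resp. to [c + b, c + 2b) contained in [A]) gives an interval of sums. The elements
   0, a0, b0 of the core, the blocks themselves, and the elements jA, jB of the middle
   part give overlapping intervals, up to where the sums of the middle part take over. *)
Lemma fringe_cover c b a0 b0 M N jA jB l :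
  (c <= b)%N -> (b0 <= a0 < c)%N -> (M <= jB <= jA)%N -> (jA < b)%N ->
  (forall i, (c <= i < c + b)%N -> (nth (false, false) l i).2) ->
  (forall i, (c + b <= i < c + b.*2)%N -> (nth (false, false) l i).1) ->
  (nth (false, false) l 0).1 ->
  (nth (false, false) l a0).1 -> (nth (false, false) l b0).2 ->
  (nth (false, false) l (c + b.*2 + jA)).1 ->
  (nth (false, false) l (c + b.*2 + jB)).2 ->
  (forall k, (M <= k < N)%N -> conv (drop (c + b.*2) l) (drop (c + b.*2) l) k) ->
  forall k, (c <= k < (c + b.*2).*2 + N)%N -> conv l l k.
Proof.
move=> cb b0a0 MjB jAb hB hA h0 ha hb hjA hjB hmid k kN; apply/convP.
have [k1|k1] := ltnP k (c + b).
  by exists 0%N, k; split=> //; apply: hB; lia.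
have [k2|k2] := ltnP k (c + b + a0).
  by exists a0, (k - a0)%N; split=> //; [lia|apply: hB; lia].
have [k3|k3] := ltnP k (c + b.*2 + b0).
  by exists (k - b0)%N, b0; split=> //; [lia|apply: hA; lia].
(* Sums of the two blocks: the first, then the last cell of the [A] block is added to the [B]
   block. *)
have [k4|k4] := ltnP k (c + b + c + b.*2).-1.
  have [k5|k5] := ltnP k (c + b.*2 + c).
    by exists (c + b)%N, (k - (c + b))%N; split=> //; [lia|apply: hA; lia|apply: hB; lia].
  exists (c + b.*2).-1, (k - (c + b.*2).-1)%N.
  by split=> //; [lia|apply: hA; lia|apply: hB; lia].
have [k5|k5] := ltnP k (c + b.*2 + jA + c + b).
  exists (c + b.*2 + jA)%N, (k - (c + b.*2 + jA))%N.
  by split=> //; [lia|apply: hB; lia].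
have [k6|k6] := ltnP k ((c + b.*2).*2 + jB).
  exists (k - (c + b.*2 + jB))%N, (c + b.*2 + jB)%N.
  by split=> //; [lia|apply: hA; lia].
have /convP[i [j [ij]]] := hmid (k - (c + b.*2).*2)%N ltac:(lia).
rewrite !nth_drop => hi hj.
by exists (c + b.*2 + i)%N, (c + b.*2 + j)%N; split=> //; lia.
Qed.

Definition window (f : pred (bool * bool)) a M (l : seq (bool * bool)) :=
  has f (take M (drop a l)).

Lemma windowP f a M l : window f a M l ->
  exists j, (a <= j < a + M)%N /\ f (nth (false, false) l j).
Proof.
case/(has_nthP (false, false)) => i; rewrite size_take size_drop => lti.
have iM : (i < M)%N by move: lti; case: ifP => //; lia.
by rewrite nth_take // nth_drop => fi; exists (a + i)%N; split => //; lia.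
Qed.

(** The two consecutive windows yield [jB] and [jA] with [M <= jB <= jA < 3M], the order required by
    [fringe_cover]. *)
Definition half_good M (l : seq (bool * bool)) :=
  [&& sums_from M l, window snd M M l & window fst (M + M) M l].

Lemma half_good_sums core b (sB sA : bool * bool) a0 b0 M mid r : let c := size core in
  sB.2 -> sA.1 -> (nth (false, false) core 0).1 ->
  (nth (false, false) core a0).1 -> (nth (false, false) core b0).2 ->
  (c + M * 3 <= b)%N -> (b0 <= a0 < c)%N ->
  half_good M mid -> size r = (c + b.*2)%N -> (M * 3 <= size mid)%N ->
  sums_from c (fringe core b sB sA ++ (mid ++ r)).
Proof.
move=> c hsB hsA h0 ha hb cb b0a0 /and3P[Hs].
move=> /windowP[jB [jBM hjB]] /windowP[jA [jAM hjA]] sr sm.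
set l := _ ++ _; have sF : size (fringe core b sB sA) = (c + b.*2)%N.
  by rewrite !size_cat !size_nseq addnn.
have lcore i : (i < c)%N -> nth (false, false) l i = nth (false, false) core i.
  by move=> ic; rewrite /l /fringe -!catA nth_cat ic.
have lmid i : (i < size mid)%N ->
    nth (false, false) l (c + b.*2 + i) = nth (false, false) mid i.
  by move=> im; rewrite /l -sF nth_cat ltnNge leq_addr /= addKn nth_cat im.
have sl : size l = ((c + b.*2) + (size mid + (c + b.*2)))%N.
  by rewrite /l size_cat sF size_cat sr.
apply/allP => k; rewrite mem_iota sl => kl.
apply: (@fringe_cover c b a0 b0 M (size mid) jA jB) => //;
  try by clear -cb b0a0 jBM jAM kl; lia.
- move=> i ic; rewrite /l /fringe -!catA nth_cat ifF -/c; last by clear -ic; lia.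
  by rewrite nth_cat size_nseq ifT ?nth_nseq ?ifT //; clear -ic; lia.
- move=> i ic; rewrite /l /fringe -!catA nth_cat ifF -/c; last by clear -ic; lia.
  rewrite nth_cat size_nseq ifF; last by clear -ic; lia.
  by rewrite nth_cat size_nseq ifT ?nth_nseq ?ifT //; clear -ic; lia.
- by rewrite lcore //; clear -b0a0; lia.
- by rewrite lcore //; clear -b0a0; lia.
- by rewrite lcore //; clear -b0a0; lia.
- by rewrite lmid //; clear -jBM jAM sm; lia.
- by rewrite lmid //; clear -jBM jAM sm; lia.
- move=> k' k'm; rewrite /l drop_size_cat //.
  have /convP[i [j [ij hi hj]]] := sums_fromP Hs k'm.
  by apply/convP; exists i, j; rewrite !nth_cat !ifT //; clear -k'm ij; lia.
Qed.

(** A form in which concrete fringes can be evaluated by [vm_compute]. *)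
Lemma fringe_mstdE z m x y : fringe_mstd z m x y =
  ((sumn [seq nat_of_bool (conv2 x y k) | k <- iota 0 m]).*2 + z
   < (sumn [seq conv x x k + conv y y k | k <- iota 0 m]).+1)%N.
Proof.
rewrite !sumnE !big_map /fringe_mstd.
by rewrite -[iota 0 m](_ : index_iota 0 m = _) ?big_mkord // /index_iota subn0.
Qed.

(** Reversed and swapped, the word starts with the fringe of [core2], so [half_good_sums] applies
    from both ends. *)
Lemma mstd_fringed core1 core2 b (sB sA : bool * bool) a0 b0 M mid : let c := size core1 in
  size core2 = c ->
  sB.2 -> sA.1 ->
  (nth (false, false) core1 0).1 -> (nth (false, false) core2 0).1 ->
  (nth (false, false) core1 a0).1 -> (nth (false, false) core2 a0).1 ->
  (nth (false, false) core1 b0).2 -> (nth (false, false) core2 b0).2 ->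
  (c + M * 3 <= b)%N -> (b0 <= a0 < c)%N ->
  fringe_mstd true c core1 (map swap core2) ->
  half_good M mid -> half_good M (map swap (rev mid)) -> (M * 3 <= size mid)%N ->
  mstd (fringe core1 b sB sA ++ (mid ++ rev (map swap (fringe core2 b sB sA)))).
Proof.
move=> c sc hsB hsA h01 h02 ha1 ha2 hb1 hb2 cb b0a0 hf g1 g2 sm.
have sF core : size core = c -> size (fringe core b sB sA) = (c + b.*2)%N.
  by move=> score; rewrite !size_cat !size_nseq addnn score.
set l := _ ++ _.
have rl : rev l =
    map swap (fringe core2 b sB sA) ++ (rev mid ++ rev (fringe core1 b sB sA)).
  by rewrite /l !rev_cat revK -catA.
have sl : size l = ((c + b.*2) + (size mid + (c + b.*2)))%N.
  by rewrite /l size_cat sF // size_cat size_rev size_map sF.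
apply: (@mstd_of_fringe (size l).-1 c).
- by rewrite sl prednK //; clear -b0a0; lia.
- by rewrite sl; clear -b0a0; lia.
- by apply: (@half_good_sums core1 b sB sA a0 b0 M mid
      (rev (map swap (fringe core2 b sB sA)))) => //; rewrite size_rev size_map sF.
- rewrite -sums_from_swap rl map_cat (mapK swapK) map_cat.
  rewrite -sc; apply: (@half_good_sums core2 b sB sA a0 b0 M) => //.
  - by rewrite sc.
  - by rewrite sc.
  - by rewrite size_map size_rev sF ?sc.
  - by rewrite size_map size_rev.
- rewrite rl /l /fringe map_cat -!catA !take_size_cat ?size_map //.
Qed.

(** * A lower bound uniform in the length *)

Section Positivity.
Variables (R : realType) (w : bool * bool -> R).
Hypothesis w_ge0 : forall s, 0 <= w s.
Hypothesis w_sum1 : \sum_s w s = 1.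
Variable t : R.
Hypothesis t_ge0 : 0 <= t.
Hypothesis t_lt1 : t < 1.
Hypothesis c_le : \sum_s \sum_(u | ~~ (s.1 && u.2)) w s * w u <= t ^+ 2.
Hypothesis A_le : \sum_(s | ~~ s.1) w s <= t.
Hypothesis B_le : \sum_(s | ~~ s.2) w s <= t.

Lemma mean_not_window (f : pred (bool * bool)) a M N : (a + M <= N)%N ->
  \sum_(s | ~~ f s) w s <= t ->
  mean w N (fun l => (~~ window f a M l)%:R) <= t ^+ M.
Proof.
move=> aMN ft; have -> : N = (a + (M + (N - (a + M))))%N by lia.
rewrite mean_cat -[leRHS](mean_const w_sum1 a); apply: le_mean => // x sx.
rewrite mean_cat; apply: (@le_trans _ _ (mean w M (fun y => (all (predC f) y)%:R))).
  apply: le_mean => // y sy; rewrite -[leRHS](mean_const w_sum1 (N - (a + M))).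
  apply: le_mean => // z _.
  by rewrite /window drop_size_cat // take_size_cat // -all_predC.
by rewrite mean_all //; apply: lerXn2r; rewrite ?nnegrE ?sumr_ge0.
Qed.

Definition good M l := half_good M l && half_good M (map swap (rev l)).

(** Union bound over two failures of sums and four empty windows. *)
Lemma mean_not_good M N : (M * 3 <= N)%N ->
  mean w N (fun l => (~~ good M l)%:R) <= t ^+ M * (2 / (1 - t) + 4).
Proof.
move=> MN.
pose r f a (l : seq (bool * bool)) := window f a M (rev l).
apply: (@le_trans _ _ (mean w N (fun l =>
  ((~~ sums_from M l)%:R + (~~ sums_from M (rev l))%:R) +
  (((~~ window snd M M l)%:R + (~~ window fst (M + M) M l)%:R) +
  ((~~ window fst M M (rev l))%:R + (~~ window snd (M + M) M (rev l))%:R))))).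
  apply: le_mean => // l sl; rewrite /good /half_good sums_from_swap.
  have win f a : window f a M (map swap (rev l)) = window (f \o swap) a M (rev l).
    by rewrite /window -map_drop -map_take has_map.
  rewrite !win -!natrD ler_nat /=.
  rewrite (_ : snd \o swap = fst) // (_ : fst \o swap = snd) //.
  by do 2!case: (sums_from _ _); do 4!case: (window _ _ _ _).
rewrite !meanD.
have h1 := mean_not_sums_from w_ge0 w_sum1 t_ge0 t_lt1 c_le N M.
have h2 := mean_not_sums_from_rev w_ge0 w_sum1 t_ge0 t_lt1 c_le N M.
rewrite (mean_rev _ _ (fun l => (~~ window fst M M l)%:R)).
rewrite (mean_rev _ _ (fun l => (~~ window snd (M + M) M l)%:R)).
rewrite (_ : _ * _ = (t ^+ M / (1 - t) + t ^+ M / (1 - t))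
  + ((t ^+ M + t ^+ M) + (t ^+ M + t ^+ M))).
  apply: lerD; first exact: lerD.
  by apply: lerD; apply: lerD; apply: mean_not_window => //; lia.
by field; rewrite subr_eq0 gt_eqF.
Qed.

Lemma mstd_prob_ge core1 core2 (sB sA : bool * bool) a0 b0 : let c := size core1 in
  size core2 = c -> sB.2 -> sA.1 ->
  (nth (false, false) core1 0).1 -> (nth (false, false) core2 0).1 ->
  (nth (false, false) core1 a0).1 -> (nth (false, false) core2 a0).1 ->
  (nth (false, false) core1 b0).2 -> (nth (false, false) core2 b0).2 ->
  (b0 <= a0 < c)%N -> fringe_mstd true c core1 (map swap core2) ->
  all (fun s => 0 < w s) [:: sB, sA & core1] ->
  all (fun s => 0 < w (swap s)) [:: sB, sA & core2] ->
  exists2 d : R, 0 < d &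
    exists N0, forall N, (N0 <= N)%N -> d <= mean w N (fun l => (mstd l)%:R).
Proof.
move=> c sc hsB hsA h01 h02 ha1 ha2 hb1 hb2 b0a0 hf pos1 pos2.
have [M HM] : exists M, t ^+ M * (2 / (1 - t) + 4) < 1 / 2.
  by apply: expr_small; [rewrite t_ge0|lra].
(* Since [M] depends on [t] only, the fringes have a fixed length [T] and the lower bound does not
   depend on [N]. The blocks are long enough for [fringe_cover], as [jA < 3M <= b]. *)
pose b := (c + M * 3)%N; pose T := (c + b.*2)%N.
pose F1 := fringe core1 b sB sA; pose F2 := rev (map swap (fringe core2 b sB sA)).
have sF1 : size F1 = T by rewrite !size_cat !size_nseq addnn.
have sF2 : size F2 = T.
  by rewrite size_rev size_map !size_cat !size_nseq addnn sc.
have W1 : 0 < \prod_(s <- F1) w s.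
  rewrite big_seq; apply: prodr_gt0 => s; rewrite !mem_cat !mem_nseq.
  by move: pos1 => /= /and3P[? ? /allP H] /or3P[/H //|/andP[_ /eqP ->]|/andP[_ /eqP ->]].
have W2 : 0 < \prod_(s <- F2) w s.
  rewrite big_seq; apply: prodr_gt0 => s; rewrite mem_rev => /mapP[u].
  rewrite !mem_cat !mem_nseq => uF ->; move: uF.
  by move: pos2 => /= /and3P[? ? /allP H] /or3P[/H //|/andP[_ /eqP ->]|/andP[_ /eqP ->]].
exists ((\prod_(s <- F1) w s) * ((\prod_(s <- F2) w s) * (1 / 2))).
  by rewrite !mulr_gt0 //; lra.
exists (T + (M * 3 + T))%N => N TN.
have -> : N = (T + ((N - T.*2) + T))%N by clear -TN; lia.
rewrite mean_cat; apply: le_trans (mean_ge_point w_ge0 _ sF1); last first.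
  by move=> l; apply: mean_bool_ge0.
apply: ler_wpM2l; first exact: ltW.
rewrite mean_cat; apply: (@le_trans _ _ (mean w (N - T.*2) (fun mid =>
  (\prod_(s <- F2) w s) * (good M mid)%:R))).
  rewrite meanZ; apply: ler_wpM2l; first exact: ltW.
  have : mean w (N - T.*2) (fun l => (good M l)%:R + (~~ good M l)%:R) = 1.
    rewrite -[RHS](mean_const w_sum1 (N - T.*2)); apply: eq_mean => l _.
    by case: good; rewrite ?addr0 ?add0r.
  have TM : (M * 3 <= N - T.*2)%N by clear -TN; lia.
  rewrite meanD; have := mean_not_good TM; clear -HM; lra.
apply: le_mean => // mid smid.
apply: le_trans (mean_ge_point w_ge0 _ sF2); last by move=> l; rewrite ler0n.
apply: ler_wpM2l; first exact: ltW.
case: (boolP (good M mid)) => [/andP[g1 g2]|_]; last by rewrite ler0n.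
by rewrite (@mstd_fringed core1 core2 b sB sA a0 b0 M) // smid; clear -TN; lia.
Qed.

End Positivity.

(** * Configurations that are never sum-dominant *)

Lemma conv_all_fst x x' y k : all fst x' -> (k < size x')%N ->
  conv x y k -> conv x' y k.
Proof.
move=> /(all_nthP (false, false)) Hx' kx' /convP[i [j [ij _ yj]]].
by apply/convP; exists i, j; split=> //; apply: Hx'; lia.
Qed.

Lemma conv_all_snd x y y' k : all snd y' -> (k < size y')%N ->
  conv x y k -> conv x y' k.
Proof.
move=> /(all_nthP (false, false)) Hy' ky' /convP[i [j [ij xi _]]].
by apply/convP; exists i, j; split=> //; apply: Hy'; lia.
Qed.

Lemma all_nth_negP (f : pred (bool * bool)) l i : f (false, false) = false ->
  all (predC f) l -> f (nth (false, false) l i) = false.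
Proof.
move=> f0 /all_nthP Hl; have [il|li] := ltnP i (size l).
  exact/negbTE/Hl.
by rewrite nth_default.
Qed.

(** If [k] or [2n - k] is a sum, then both [n - k] and [k - n] are differences, so the two
    differences outweigh the at most two sums. *)
Lemma mstdF l : (0 < size l)%N ->
  (forall k, (k < size l)%N -> conv l l k -> conv2 l (rev l) k) ->
  (forall k, (k < size l)%N -> conv (rev l) (rev l) k -> conv2 l (rev l) k) ->
  mstd l = false.
Proof.
move=> l0 Hl Hr; apply/negbTE; rewrite /mstd -leqNgt; apply: leq_add; last first.
  by have := Hl (size l).-1; rewrite prednK // leqnn; case: conv => // /(_ _ _) ->.
rewrite -muln2 big_distrl /=; apply: leq_sum => k _.
have kl : (k < size l)%N by have := ltn_ord k; lia.
have := Hl k kl; have := Hr k kl.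
by case: (conv l l k) (conv (rev l) (rev l) k) => [] [] // => [->|_ ->|->].
Qed.

(** A word contained in [A] can be replaced by its reversal as first factor, which turns a sum into
    a difference. *)
Lemma mstd_all_fst l : (0 < size l)%N -> all fst l -> mstd l = false.
Proof.
move=> l0 Hl; apply: mstdF => // k kl H; apply/orP.
  by right; apply: (conv_all_fst _ _ H); rewrite ?all_rev ?size_rev.
by left; apply: (conv_all_fst _ _ H).
Qed.

Lemma mstd_all_snd l : (0 < size l)%N -> all snd l -> mstd l = false.
Proof.
move=> l0 Hl; apply: mstdF => // k kl H; apply/orP.
  by left; apply: (conv_all_snd _ _ H); rewrite ?all_rev ?size_rev.
by right; apply: (conv_all_snd _ _ H).
Qed.

Lemma mstd_no_fst l : (0 < size l)%N -> all (predC fst) l -> mstd l = false.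
Proof.
move=> l0 Hl; have Hr : all (predC fst) (rev l) by rewrite all_rev.
by apply: mstdF => // k _ /convP[i [j [_]]]; rewrite (@all_nth_negP fst).
Qed.

Lemma mstd_no_snd l : (0 < size l)%N -> all (predC snd) l -> mstd l = false.
Proof.
move=> l0 Hl; have Hr : all (predC snd) (rev l) by rewrite all_rev.
by apply: mstdF => // k _ /convP[i [j [_ _]]]; rewrite (@all_nth_negP snd).
Qed.

Lemma sum_cells (R : nmodType) (F : bool * bool -> R) :
  \sum_s F s = F (true, true) + F (true, false) + (F (false, true) + F (false, false)).
Proof.
by rewrite (eq_bigr (fun s => F (s.1, s.2))) => [|[]] //;
  rewrite -(pair_bigA _ (fun a b => F (a, b))) big_bool /= !big_bool.
Qed.

(** * The law of one cell of a correlated pair *)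

Section CellWeight.
Variables (R : realType) (p rho1 rho2 : R).
Hypotheses (hp : 0 <= p <= 1) (hrho1 : 0 <= rho1 <= 1) (hrho2 : 0 <= rho2 <= 1).

Local Notation w := (cell_weight p rho1 rho2).

Lemma cell_weight_ge0 s : 0 <= w s.
Proof.
move: hp hrho1 hrho2 => /andP[? ?] /andP[? ?] /andP[? ?].
by case: s => [[] []]; rewrite /cell_weight /elt_weight /=; apply: mulr_ge0; lra.
Qed.

Lemma cell_weight_sum1 : \sum_s w s = 1.
Proof. by rewrite sum_cells /cell_weight /elt_weight /=; ring. Qed.

Lemma MSTD_prob_degenerate n :
  (p = 0 \/ p = 1) \/ (rho1 + rho2 = 0 \/ rho1 + rho2 = 2) ->
  MSTD_prob p rho1 rho2 n = 0.
Proof.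
move: (hrho1) (hrho2) => /andP[? ?] /andP[? ?] H.
(* In each degenerate case all letters of nonzero weight share a property [f] that excludes
   sum-dominance. *)
have mean0 (f : pred (bool * bool)) : (forall s, w s != 0 -> f s) ->
    (forall l, (0 < size l)%N -> all f l -> mstd l = false) ->
    MSTD_prob p rho1 rho2 n = 0.
  move=> wf fl; rewrite MSTD_prob_mean; apply/eqP; rewrite eq_le.
  rewrite (mean_bool_ge0 cell_weight_ge0 cell_weight_sum1) andbT.
  rewrite -[leRHS](mean_const cell_weight_sum1 n.+1).
  apply: le_mean_support => [|l sl al]; first exact: cell_weight_ge0.
  by rewrite fl ?sl //; apply: sub_all al => s; apply: wf.
case: H => [[] p_eq|[] rho_eq].
- apply: (mean0 (predC fst)) => [|l l0]; last exact: mstd_no_fst.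
  by case=> [[] b] //; rewrite /cell_weight /elt_weight /= p_eq mul0r eqxx.
- apply: (mean0 fst) => [|l l0]; last exact: mstd_all_fst.
  by case=> [[] b] //; rewrite /cell_weight /elt_weight /= p_eq subrr mul0r eqxx.
- have [r1 r2] : rho1 = 0 /\ rho2 = 0 by split; lra.
  apply: (mean0 (predC snd)) => [|l l0]; last exact: mstd_no_snd.
  by case=> [[] []] //; rewrite /cell_weight /elt_weight /= ?r1 ?r2 mulr0 eqxx.
- have [r1 r2] : rho1 = 1 /\ rho2 = 1 by split; lra.
  apply: (mean0 snd) => [|l l0]; last exact: mstd_all_snd.
  by case=> [[] []] //; rewrite /cell_weight /elt_weight /= ?r1 ?r2 subrr mulr0 eqxx.
Qed.

Hypothesis nondegenerate :
  ~ ((p = 0 \/ p = 1) \/ (rho1 + rho2 = 0 \/ rho1 + rho2 = 2)).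

(** The probability that a cell lies in [B]. *)
Let q := p * rho1 + (1 - p) * rho2.

Let p01 : 0 < p < 1.
Proof.
move: hp => /andP[p0 p1]; rewrite !lt_neqAle p0 p1 !andbT.
by apply/andP; split; apply/eqP => pE; apply: nondegenerate; left; [left|right].
Qed.

Let q0 : 0 < q.
Proof.
move: hrho1 hrho2 p01 => /andP[? ?] /andP[? ?] /andP[? ?].
have h1 : 0 <= p * rho1 by rewrite mulr_ge0 // ltW.
have h2 : 0 <= (1 - p) * rho2 by rewrite mulr_ge0 // subr_ge0 ltW.
rewrite lt_neqAle addr_ge0 // andbT eq_sym /q paddr_eq0 // !mulf_eq0.
apply/negP => /andP[/orP[/eqP|/eqP r1]]; first lra.
by case/orP => [/eqP|/eqP r2]; [lra|apply: nondegenerate; right; left; lra].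
Qed.

Let q1 : q <= 1.
Proof. by move: hrho1 hrho2 p01 => /andP[? ?] /andP[? ?] /andP[? ?]; rewrite /q; nra. Qed.

Lemma decay_rate : exists t : R, [/\ 0 <= t < 1,
  \sum_s \sum_(u | ~~ (s.1 && u.2)) w s * w u <= t ^+ 2,
  \sum_(s | ~~ s.1) w s <= t, \sum_(s | ~~ s.2) w s <= t
  & w (true, true) != 0 -> 1 - w (true, true) <= t].
Proof.
move: (hrho1) (p01) => /andP[r0 r1] /andP[p0 p1].
(* The factor [y] ensures [x <= p * rho1] when [rho1] is nonzero, while keeping [x] positive when
   [rho1 = 0]. *)
pose y := if rho1 == 0 then 1 else rho1.
have y0 : 0 < y by rewrite /y; case: eqVneq => [_|r]; [lra|rewrite lt_neqAle eq_sym r].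
have y1 : y <= 1 by rewrite /y; case: eqVneq.
have pq0 : 0 < p * q by apply: mulr_gt0.
pose x := p * q * y; have x0 : 0 < x by apply: mulr_gt0.
have xpq : x <= p * q by rewrite /x ger_pMr.
have pqp : p * q <= p by rewrite ger_pMr.
have pqq : p * q <= q by rewrite ger_pMl // ltW.
(* Halving [x] leaves room for the square: [(1 - x / 2) ^+ 2 >= 1 - x >= 1 - p * q]. *)
exists (1 - x / 2); split; [lra| | | |].
- rewrite [leLHS](_ : _ = 1 - p * q); first by rewrite expr2; nra.
  under eq_bigr do rewrite big_mkcond.
  by rewrite !sum_cells /cell_weight /elt_weight /= /q; ring.
- rewrite big_mkcond sum_cells /cell_weight /elt_weight /=; lra.
- rewrite [leLHS](_ : _ = 1 - q); first lra.
  by rewrite big_mkcond sum_cells /cell_weight /elt_weight /= /q; ring.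
- rewrite /cell_weight /elt_weight /= mulf_eq0 negb_or => /andP[_ rn].
  have xE : x <= p * rho1.
    by rewrite /x /y (negbTE rn) mulrAC ger_pMr // mulr_gt0 // lt_neqAle eq_sym rn.
  lra.
Qed.

Lemma is_cvg_MSTD_prob : cvgn (fun n => MSTD_prob p rho1 rho2 n).
Proof.
have [t [/andP[t0 t1] ct _ _ zt]] := decay_rate.
pose L m := mean w m (fun x => mean w m (fun y =>
  (fringe_mstd (w (true, true) != 0) m x y)%:R)).
apply: (@is_cvg_approx _ _ L t (3 / (1 - t) + 1)); first by rewrite t0.
move=> m n mn; rewrite MSTD_prob_mean.
exact: (mean_mstd_approx cell_weight_ge0 cell_weight_sum1 t0 t1 ct zt).
Qed.

(* Either both "in A and B" and "in neither", or both "in A only" and "in B only",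
   have positive weight. In the first case the cores [{0, 2, 3}] and
   [{0, 1, 2, 5}] of Martin and O'Bryant make one sum and two differences
   disappear. In the second case [B] is the complement of [A] on the fringe, whose
   left and right ends are both equal to u = (110100)^3: missing sums correspond to
   palindromic prefixes and suffixes of u (two each), missing differences to its
   borders (three, each counted twice). *)
Lemma MSTD_prob_ge : exists2 d : R, 0 < d &
  exists N0, forall n, (N0 <= n)%N -> d <= MSTD_prob p rho1 rho2 n.
Proof.
move: (hrho1) (hrho2) (p01) => /andP[? ?] /andP[? ?] /andP[p0 p1].
have [t [/andP[t0 t1] ct At Bt _]] := decay_rate.
suff [d d0 [N0 HN]] : exists2 d : R, 0 < d &
    exists N0, forall N, (N0 <= N)%N -> d <= mean w N (fun l => (mstd l)%:R).
  by exists d => //; exists N0 => n Nn; rewrite MSTD_prob_mean HN // ltnW.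
have main := mstd_prob_ge cell_weight_ge0 cell_weight_sum1 t0 t1 ct At Bt.
have [/andP[r1 r2]|/nandP H] := boolP ((0 < rho1) && (rho2 < 1)).
  pose i := (true, true); pose o := (false, false).
  have wi : 0 < w i by rewrite /cell_weight /elt_weight /= mulr_gt0.
  have wo : 0 < w o by rewrite /cell_weight /elt_weight /= mulr_gt0 // subr_gt0.
  (* Padding to length 7 puts the missing sum 1 and the missing differences [n - 6] and [6 - n]
     inside the fringe. *)
  apply: (main [:: i; o; i; i; o; o; o] [:: i; i; i; o; o; i; o] i i 0%N 0%N) => //=.
  - by rewrite fringe_mstdE; vm_compute.
  - by rewrite wi wo.
  - by rewrite /swap /= wi wo.
have [r1 r2] : rho1 < 1 /\ 0 < rho2.
  have hne a : a = 0 \/ a = 2 -> rho1 + rho2 <> a.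
    by move=> a02 ra; apply: nondegenerate; right; rewrite ra.
  have := hne 0 (or_introl erefl); have := hne 2 (or_intror erefl).
  by case: H; rewrite -leNgt => H ? ?; split; rewrite ltNge; apply/negP => ?; lra.
pose i := (true, false); pose o := (false, true).
have wi : 0 < w i by rewrite /cell_weight /elt_weight /= mulr_gt0 // subr_gt0.
have wo : 0 < w o by rewrite /cell_weight /elt_weight /= mulr_gt0 // subr_gt0.
pose u := [:: i; i; o; i; o; o; i; i; o; i; o; o; i; i; o; i; o; o].
(* Reversing and swapping fixes [u], so the right end is again [u]. Cell 3 of [u] lies in [A] and
   cell 2 in [B]. *)
apply: (main u u o i 3%N 2%N) => //=.
- by rewrite fringe_mstdE; vm_compute.
- by rewrite wi wo.
- by rewrite /swap /= wi wo.
Qed.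

End CellWeight.

Theorem theorem1p1 (R : realType) (p rho1 rho2 : R)
    (hp : 0 <= p <= 1) (hrho1 : 0 <= rho1 <= 1) (hrho2 : 0 <= rho2 <= 1) :
  exists P : R,
    [/\ (fun n : nat => MSTD_prob p rho1 rho2 n) @ \oo --> P,
        (p = 0 \/ p = 1) \/ (rho1 + rho2 = 0 \/ rho1 + rho2 = 2) -> P = 0
      & ~ ((p = 0 \/ p = 1) \/ (rho1 + rho2 = 0 \/ rho1 + rho2 = 2)) -> 0 < P].
Proof.
have [deg|ndeg] :=
  pselect ((p = 0 \/ p = 1) \/ (rho1 + rho2 = 0 \/ rho1 + rho2 = 2)).
  exists 0; split => //.
  rewrite (_ : (fun n => _) = fun=> 0); first exact: cvg_cst.
  by apply/funext => n; apply: MSTD_prob_degenerate.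
have cvgP := is_cvg_MSTD_prob hp hrho1 hrho2 ndeg.
exists (lim ((fun n => MSTD_prob p rho1 rho2 n) @ \oo)); split => // _.
have [d d0 [N0 HN]] := MSTD_prob_ge hp hrho1 hrho2 ndeg.
apply: lt_le_trans d0 _; apply: limr_ge => //.
by exists N0 => // n /= Nn; apply: HN.
Qed.
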